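(* Let $N\ge1$ and let $\mathbf{D}=(D_{im})_{i,m=0}^N$ be the polynomial derivative matrix on the Gauss-Lobatto nodes. Let $F^{\#},G^{\#},H^{\#}$ be consistent and symmetric two-point numerical volume fluxes for the 3D compressible Euler equations (in the $x,y,z$ directions), and suppose that their mass and momentum components satisfy $$F^{\#,2}=F^{\#,1}\{\{u\}\}+\widetilde p,\quad F^{\#,3}=F^{\#,1}\{\{v\}\},\quad F^{\#,4}=F^{\#,1}\{\{w\}\},$$ $$G^{\#,2}=G^{\#,1}\{\{u\}\},\quad G^{\#,3}=G^{\#,1}\{\{v\}\}+\widetilde p,\quad G^{\#,4}=G^{\#,1}\{\{w\}\},$$ $$H^{\#,2}=H^{\#,1}\{\{u\}\},\quad H^{\#,3}=H^{\#,1}\{\{v\}\},\quad H^{\#,4}=H^{\#,1}\{\{w\}\}+\widetilde p,$$ where $\widetilde p$ is a consistent and symmetric two-point approximation of the pressure and $\{\{\cdot\}\}$ is the arithmetic mean over the two argument states. Then the volume terms of the flux differencing discretisation are kinetic energy preserving in the sense of Jameson, i.e. the advective terms in the discrete kinetic energy balance can be re-cast into conservative form and only the approximation of the pressure work is in non-conservative form. More precisely, for all $i,j,k\in\{0,\dots,N\}$, the volume terms of the discrete kinetic energy balance are given by $$\left(\frac{\partial\kappa}{\partial t}\right)_{ijk}=-2\sum_{m=0}^N\Big[D_{im}f^{\#,\kappa}(U_{ijk},U_{mjk})+D_{jm}g^{\#,\kappa}(U_{ijk},U_{imk})+D_{km}h^{\#,\kappa}(U_{ijk},U_{ijm})\Big]$$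 $$\qquad-2\sum_{m=0}^N\Big[u_{ijk}D_{im}\widetilde p(U_{ijk},U_{mjk})+v_{ijk}D_{jm}\widetilde p(U_{ijk},U_{imk})+w_{ijk}D_{km}\widetilde p(U_{ijk},U_{ijm})\Big],$$ with $$f^{\#,\kappa}(U_{ijk},U_{mjk}):=\tfrac12F^{\#,1}(U_{ijk},U_{mjk})\left(u_{ijk}u_{mjk}+v_{ijk}v_{mjk}+w_{ijk}w_{mjk}\right),$$ $$g^{\#,\kappa}(U_{ijk},U_{imk}):=\tfrac12G^{\#,1}(U_{ijk},U_{imk})\left(u_{ijk}u_{imk}+v_{ijk}v_{imk}+w_{ijk}w_{imk}\right),$$ $$h^{\#,\kappa}(U_{ijk},U_{ijm}):=\tfrac12H^{\#,1}(U_{ijk},U_{ijm})\left(u_{ijk}u_{ijm}+v_{ijk}v_{ijm}+w_{ijk}w_{ijm}\right),$$ and these advective kinetic energy fluxes are symmetric in their two arguments and consistent with the fluxes $\frac12\rho u(u^2+v^2+w^2)$, $\frac12\rho v(u^2+v^2+w^2)$, $\frac12\rho w(u^2+v^2+w^2)$ of the continuous kinetic energy balance, respectively.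
   Context: State: $U=(\rho,\rho u,\rho v,\rho w,\rho e)$ with $\rho>0$, velocity $(u,v,w)$, pressure $p=(\gamma-1)\left(\rho e-\frac12\rho(u^2+v^2+w^2)\right)$. The Euler fluxes are $F(U)=(\rho u,\rho u^2+p,\rho uv,\rho uw,(\rho e+p)u)$, $G(U)=(\rho v,\rho uv,\rho v^2+p,\rho vw,(\rho e+p)v)$, $H(U)=(\rho w,\rho uw,\rho vw,\rho w^2+p,(\rho e+p)w)$. A two-point flux $F^{\#}(U_1,U_2)$ is consistent if $F^{\#}(U,U)=F(U)$ and symmetric if $F^{\#}(U_1,U_2)=F^{\#}(U_2,U_1)$; likewise for $G^{\#},H^{\#}$ and for $\widetilde p$ (consistent: $\widetilde p(U,U)=p(U)$). Superscript $l$ in $F^{\#,l}$ denotes the $l$-th component. Derivative matrix: $D_{im}=\ell_m'(\xi_i)$, where $\ell_m$ are the Lagrange basis polynomials of the $N+1$ Gauss-Lobatto nodes on $[-1,1]$. Volume terms of the flux differencing discretisation: nodal states $U_{ijk}$, $0\le i,j,k\le N$, on a tensor-product element (constant Cartesian metric factors suppressed); the volume contribution to the time derivative of component $l$ at node $ijk$ is $$(U^l_t)_{ijk}=-2\sum_{m=0}^N\Big[D_{im}F^{\#,l}(U_{ijk},U_{mjk})+D_{jm}G^{\#,l}(U_{ijk},U_{imk})+D_{km}H^{\#,l}(U_{ijk},U_{ijm})\Big].$$ Kinetic energy: $\kappa=\frac12\rho(u^2+v^2+w^2)=\frac{(\rho u)^2+(\rho v)^2+(\rho w)^2}{2\rho}$.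 The volume terms of the discrete kinetic energy balance are obtained by inserting the volume contributions $(U^l_t)_{ijk}=-2\sum_{m=0}^N\big[D_{im}F^{\#,l}(U_{ijk},U_{mjk})+D_{jm}G^{\#,l}(U_{ijk},U_{imk})+D_{km}H^{\#,l}(U_{ijk},U_{ijm})\big]$, $l=1,2,3,4$ (that is, for $\rho,\rho u,\rho v,\rho w$), in the chain rule at each node: $\frac{\partial\kappa}{\partial t}=-\frac{u^2+v^2+w^2}{2}(\rho)_t+u(\rho u)_t+v(\rho v)_t+w(\rho w)_t$. The continuous balance is $\kappa_t+\left(\frac12\rho u(u^2+v^2+w^2)\right)_x+\left(\frac12\rho v(u^2+v^2+w^2)\right)_y+\left(\frac12\rho w(u^2+v^2+w^2)\right)_z+u\,p_x+v\,p_y+w\,p_z=0$; the last three terms are the pressure work. An advective term is in (discrete) conservative form when it is of flux differencing form $2\sum_m D_{im}f^{\#}(\cdot,\cdot)$ with a symmetric, consistent two-point flux $f^{\#}$. *)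

(* Defs.v *)
From HB Require Import structures.
From mathcomp Require Import all_boot all_order all_algebra.
From mathcomp Require Import reals.
From mathcomp Require Import classical_sets topology normedtype derive.
From mathcomp Require Import ring.

Set Implicit Arguments.
Unset Strict Implicit.
Unset Printing Implicit Defensive.

Import Order.TTheory GRing.Theory Num.Theory.
Import numFieldNormedType.Exports.

Local Open Scope ring_scope.

(** The five components are indexed by 'I_5: 0, 1, 2, 3, 4 stand for density,
    the three momenta and total energy (1, ..., 5 in the usual superscripts). *)
Record state (R : realType) := State {
  cons_vars :> 'rV[R]_5;
  density_gt0 : 0 < cons_vars 0 0
}.

Section Euler.
Variable R : realType.
Implicit Type U : state R.

Definition rho U : R := cons_vars U 0 0.
Definition velx U : R := cons_vars U 0 1 / rho U.
Definition vely U : R := cons_vars U 0 2 / rho U.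
Definition velz U : R := cons_vars U 0 3 / rho U.
Definition energy U : R := cons_vars U 0 4.

Definition speed2 U : R := velx U ^+ 2 + vely U ^+ 2 + velz U ^+ 2.

Definition pressure (gamma : R) U : R :=
  (gamma - 1) * (energy U - rho U * speed2 U / 2).

Definition euler_flux_x (gamma : R) U : 'rV[R]_5 :=
  \row_(l < 5) [:: rho U * velx U;
                   rho U * velx U ^+ 2 + pressure gamma U;
                   rho U * velx U * vely U;
                   rho U * velx U * velz U;
                   (energy U + pressure gamma U) * velx U]`_l.

Definition euler_flux_y (gamma : R) U : 'rV[R]_5 :=
  \row_(l < 5) [:: rho U * vely U;
                   rho U * velx U * vely U;
                   rho U * vely U ^+ 2 + pressure gamma U;
                   rho U * vely U * velz U;
                   (energy U + pressure gamma U) * vely U]`_l.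

Definition euler_flux_z (gamma : R) U : 'rV[R]_5 :=
  \row_(l < 5) [:: rho U * velz U;
                   rho U * velx U * velz U;
                   rho U * vely U * velz U;
                   rho U * velz U ^+ 2 + pressure gamma U;
                   (energy U + pressure gamma U) * velz U]`_l.

Definition kinetic_energy U : R := rho U * speed2 U / 2.

Definition ke_flux_x U : R := rho U * velx U * speed2 U / 2.
Definition ke_flux_y U : R := rho U * vely U * speed2 U / 2.
Definition ke_flux_z U : R := rho U * velz U * speed2 U / 2.

(** Time derivative of the kinetic energy at the state U when the conserved
    variables evolve at the rate Ut; see [is_derive_kinetic_energy]. *)
Definition kinetic_energy_rate U (Ut : 'rV[R]_5) : R :=
  - (speed2 U / 2) * Ut 0 0
  + velx U * Ut 0 1 + vely U * Ut 0 2 + velz U * Ut 0 3.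

Lemma is_derive_kinetic_energy (U : R -> state R) (Ut : 'rV[R]_5) (t : R) :
  (forall l : 'I_5,
     is_derive t (1 : R) (fun s => cons_vars (U s) 0 l : R) (Ut 0 l)) ->
  is_derive t (1 : R) (fun s => kinetic_energy (U s) : R)
    (kinetic_energy_rate (U t) Ut).
Proof.
move=> dU.
pose q l (s : R) : R := cons_vars (U s) 0 l.
have q0 s : q 0 s != 0 by rewrite gt_eqF// density_gt0.
have dq l : is_derive t (1 : R) (q l) (Ut 0 l) by exact: dU.
have dsq l := is_deriveM (dq l) (dq l).
have dnum := is_deriveD (is_deriveD (dsq 1) (dsq 2)) (dsq 3).
have dinv := DeriveDef (derivableV (q0 t) (@ex_derive _ _ _ _ _ _ _ (dq 0)))
                      (deriveV (q0 t) (@ex_derive _ _ _ _ _ _ _ (dq 0))).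
rewrite (@derive_val _ _ _ _ _ _ _ (dq 0)) in dinv.
have dke := is_deriveZ 2^-1 (is_deriveM dnum dinv).
have keE : (fun s => kinetic_energy (U s)) =
    (fun s => 2^-1 * ((q 1 s * q 1 s + q 2 s * q 2 s + q 3 s * q 3 s)
                      * (q 0 s)^-1)).
  apply/boolp.funext => s.
  rewrite /kinetic_energy /speed2 /velx /vely /velz /rho -!/(q _ s).
  by field; rewrite q0.
rewrite keE; apply: (is_derive_eq dke).
rewrite /kinetic_energy_rate /speed2 /velx /vely /velz /rho -!/(q _ t).
rewrite !functions.fctE /GRing.scale /=.
by field; rewrite q0.
Qed.

End Euler.

Section TwoPoint.
Variables (R : realType) (V : Type).

Definition consistent_with (f2 : state R -> state R -> V) (f : state R -> V) :=
  forall U, f2 U U = f U.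

Definition symmetric_flux (f2 : state R -> state R -> V) :=
  forall U1 U2, f2 U1 U2 = f2 U2 U1.

Definition conservative_flux (f2 : state R -> state R -> V)
    (f : state R -> V) :=
  symmetric_flux f2 /\ consistent_with f2 f.

End TwoPoint.

Definition mean (R : realType) (q : state R -> R) (U1 U2 : state R) : R :=
  (q U1 + q U2) / 2.

(** Rodrigues' formula. *)
Definition legendre (R : realType) (n : nat) : {poly R} :=
  (2 ^+ n * n`!%:R)^-1 *: (('X^2 - 1) ^+ n)^`(n).

(** For N >= 1 the N+1 Gauss-Lobatto nodes, in increasing order, are the zeros
    of (1 - x^2) P_N'(x); this polynomial has degree N+1, so increasing order
    makes the family exhaust its zeros. *)
Definition gauss_lobatto_nodes (R : realType) (N : nat)
    (xi : 'I_N.+1 -> R) : Prop :=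
  (forall i, root ((1 - 'X^2) * (legendre R N)^`()) (xi i)) /\
  (forall i j : 'I_N.+1, (i < j)%N -> xi i < xi j).

(** [qpoly.lagrange] would require a sampling function injective on all of
    nat. *)
Definition lagrange_basis (R : realType) (N : nat) (xi : 'I_N.+1 -> R)
    (m : 'I_N.+1) : {poly R} :=
  \prod_(j < N.+1 | j != m) ((xi m - xi j)^-1 *: ('X - (xi j)%:P)).

Definition derivative_matrix (R : realType) (N : nat) (xi : 'I_N.+1 -> R) :
    'M[R]_N.+1 :=
  \matrix_(i, m) ((lagrange_basis xi m)^`()).[xi i].

Definition nodal_states (R : realType) (N : nat) :=
  'I_N.+1 -> 'I_N.+1 -> 'I_N.+1 -> state R.

Section Discretisation.
Variables (R : realType) (N : nat) (D : 'M[R]_N.+1).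
Implicit Types (U : nodal_states R N) (i j k : 'I_N.+1).

Definition flux_differencing (f g h : state R -> state R -> R) U i j k : R :=
  2 * \sum_(m < N.+1) (D i m * f (U i j k) (U m j k)
                     + D j m * g (U i j k) (U i m k)
                     + D k m * h (U i j k) (U i j m)).

Definition volume_terms (F G H : state R -> state R -> 'rV[R]_5) U i j k :
    'rV[R]_5 :=
  \row_l (- flux_differencing (fun V W => F V W 0 l)
                              (fun V W => G V W 0 l)
                              (fun V W => H V W 0 l) U i j k).

Definition kinetic_energy_volume_terms
    (F G H : state R -> state R -> 'rV[R]_5) U i j k : R :=
  kinetic_energy_rate (U i j k) (volume_terms F G H U i j k).

Definition pressure_work (pt : state R -> state R -> R) U i j k : R :=
  2 * \sum_(m < N.+1) (velx (U i j k) * D i m * pt (U i j k) (U m j k)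
                     + vely (U i j k) * D j m * pt (U i j k) (U i m k)
                     + velz (U i j k) * D k m * pt (U i j k) (U i j m)).

(** Jameson's notion: the advective part of the discrete kinetic energy
    balance is of conservative form, and only a consistent discretisation of
    the pressure work u p_x + v p_y + w p_z is not. *)
Definition kinetic_energy_preserving (gamma : R)
    (F G H : state R -> state R -> 'rV[R]_5) : Prop :=
  exists (f g h pt : state R -> state R -> R),
    [/\ conservative_flux f (@ke_flux_x R),
        conservative_flux g (@ke_flux_y R),
        conservative_flux h (@ke_flux_z R),
        conservative_flux pt (pressure gamma) &
        forall U i j k,
          kinetic_energy_volume_terms F G H U i j k =
          - flux_differencing f g h U i j k - pressure_work pt U i j k].

End Discretisation.

(** The advective kinetic energy flux built from a mass flux [fm]. *)
Definition ke_flux2 (R : realType) (fm : state R -> state R -> R)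
    (U1 U2 : state R) : R :=
  2^-1 * fm U1 U2
  * (velx U1 * velx U2 + vely U1 * vely U2 + velz U1 * velz U2).

(* Main.v *)
Require Import Defs.
From mathcomp Require Import all_boot all_order all_algebra.
From mathcomp Require Import reals ring.
Import Order.TTheory GRing.Theory Num.Theory.
Local Open Scope ring_scope.

(** The balance holds pair of nodes by pair of nodes. The chain rule
    contracts a rate [Ut] of the conserved variables with the gradient
    [(- |V|^2 / 2, u, v, w)] of the kinetic energy at the node where the rate
    is taken ([V] is the velocity there), and this contraction is linear in
    [Ut]. It can therefore be moved inside the sums over [m] and applied to
    each two-point flux separately ([kinetic_energy_volume_termsE]).

    There, a momentum flux equal to the mass flux [f] times the mean velocity
    contributes [u1 * f * (u1 + u2) / 2], while the mass equation contributes
    [- f * u1 ^+ 2 / 2] in the same direction. The squares cancel and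
    [f * u1 * u2 / 2] remains, which is symmetric as soon as [f] is; the
    pressure added to one momentum component leaves the velocity of the
    node where the balance is taken times that pressure
    ([kinetic_energy_rate_mean_flux]). Adding the contributions of the three
    velocity components gives the advective flux [ke_flux2 f] plus the
    pressure work.

    At equal states the product of velocities is the squared speed, so this
    advective flux reduces to the mass flux times [speed2 / 2]; consistency
    of the mass flux makes that the physical kinetic energy flux
    ([conservative_ke_flux2]). *)

(** Symmetry and consistency are both inherited from the mass flux: the factor
    [u1 * u2 + v1 * v2 + w1 * w2] is symmetric and equals [speed2] at equal
    states. The quantity [q] stands for the mass flux [rho u], [rho v] or
    [rho w] of one coordinate direction. *)
Lemma conservative_ke_flux2 (R : realType) (fm : state R -> state R -> R)
    (q : state R -> R) :
  conservative_flux fm q ->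
  conservative_flux (ke_flux2 fm) (fun U => q U * speed2 U / 2).
Proof.
move=> [fm_sym fm_cons]; split=> [U1 U2 | U].
  by rewrite /ke_flux2 fm_sym; ring.
by rewrite /ke_flux2 fm_cons /speed2; field.
Qed.

(** The cancellation behind kinetic energy preservation:
    [- u1 ^+ 2 / 2 + u1 * (u1 + u2) / 2 = u1 * u2 / 2] in each direction. One
    pressure per momentum component is allowed, so that the fluxes in all
    three coordinate directions are instances. *)
Lemma kinetic_energy_rate_mean_flux (R : realType)
    (F : state R -> state R -> 'rV[R]_5) (px py pz : R) (U1 U2 : state R) :
  F U1 U2 0 1 = F U1 U2 0 0 * mean (@velx R) U1 U2 + px ->
  F U1 U2 0 2 = F U1 U2 0 0 * mean (@vely R) U1 U2 + py ->
  F U1 U2 0 3 = F U1 U2 0 0 * mean (@velz R) U1 U2 + pz ->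
  kinetic_energy_rate U1 (F U1 U2) =
    ke_flux2 (fun V W => F V W 0 0) U1 U2
    + (velx U1 * px + vely U1 * py + velz U1 * pz).
Proof.
move=> Fx Fy Fz.
rewrite /kinetic_energy_rate /ke_flux2 Fx Fy Fz /mean /speed2.
by field.
Qed.

(** The rate is contracted with a gradient that depends only on the node where
    it is taken, not on the summation index, so contracting the sum of the
    two-point fluxes is the same as summing their contractions. The balance
    thereby reduces to an identity for a single pair of states. *)
Lemma kinetic_energy_volume_termsE (R : realType) (N : nat) (D : 'M[R]_N.+1)
    (F G H : state R -> state R -> 'rV[R]_5) (U : nodal_states R N)
    (i j k : 'I_N.+1) :
  kinetic_energy_volume_terms D F G H U i j k =
    - flux_differencing D (fun V W => kinetic_energy_rate V (F V W))
                          (fun V W => kinetic_energy_rate V (G V W))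
                          (fun V W => kinetic_energy_rate V (H V W)) U i j k.
Proof.
rewrite /kinetic_energy_volume_terms {1}/kinetic_energy_rate !mxE.
rewrite /flux_differencing !mulrN !mulr_sumr -!sumrN -!big_split /=.
by apply: eq_bigr => m _; rewrite /kinetic_energy_rate; ring.
Qed.

Theorem theorem2 (R : realType) (gamma : R) (N : nat) (hN : (1 <= N)%N)
    (xi : 'I_N.+1 -> R) (hxi : gauss_lobatto_nodes xi)
    (F G H : state R -> state R -> 'rV[R]_5) (pt : state R -> state R -> R)
    (Fsym : symmetric_flux F) (Fcons : consistent_with F (euler_flux_x gamma))
    (Gsym : symmetric_flux G) (Gcons : consistent_with G (euler_flux_y gamma))
    (Hsym : symmetric_flux H) (Hcons : consistent_with H (euler_flux_z gamma))
    (ptsym : symmetric_flux pt) (ptcons : consistent_with pt (pressure gamma))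
    (hF : forall U1 U2 : state R,
      [/\ F U1 U2 0 1 = F U1 U2 0 0 * mean (@velx R) U1 U2 + pt U1 U2,
          F U1 U2 0 2 = F U1 U2 0 0 * mean (@vely R) U1 U2 &
          F U1 U2 0 3 = F U1 U2 0 0 * mean (@velz R) U1 U2])
    (hG : forall U1 U2 : state R,
      [/\ G U1 U2 0 1 = G U1 U2 0 0 * mean (@velx R) U1 U2,
          G U1 U2 0 2 = G U1 U2 0 0 * mean (@vely R) U1 U2 + pt U1 U2 &
          G U1 U2 0 3 = G U1 U2 0 0 * mean (@velz R) U1 U2])
    (hH : forall U1 U2 : state R,
      [/\ H U1 U2 0 1 = H U1 U2 0 0 * mean (@velx R) U1 U2,
          H U1 U2 0 2 = H U1 U2 0 0 * mean (@vely R) U1 U2 &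
          H U1 U2 0 3 = H U1 U2 0 0 * mean (@velz R) U1 U2 + pt U1 U2]) :
  let D := derivative_matrix xi in
  let fk := ke_flux2 (fun U1 U2 => F U1 U2 0 0) in
  let gk := ke_flux2 (fun U1 U2 => G U1 U2 0 0) in
  let hk := ke_flux2 (fun U1 U2 => H U1 U2 0 0) in
  [/\ kinetic_energy_preserving D gamma F G H,
      forall (U : nodal_states R N) (i j k : 'I_N.+1),
        kinetic_energy_volume_terms D F G H U i j k =
        - 2 * (\sum_(m < N.+1) (D i m * fk (U i j k) (U m j k)
                              + D j m * gk (U i j k) (U i m k)
                              + D k m * hk (U i j k) (U i j m)))
        - 2 * (\sum_(m < N.+1)
                 (velx (U i j k) * D i m * pt (U i j k) (U m j k)
                + vely (U i j k) * D j m * pt (U i j k) (U i m k)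
                + velz (U i j k) * D k m * pt (U i j k) (U i j m))),
      [/\ symmetric_flux fk, symmetric_flux gk & symmetric_flux hk] &
      [/\ consistent_with fk (@ke_flux_x R),
          consistent_with gk (@ke_flux_y R) &
          consistent_with hk (@ke_flux_z R)]].
Proof.
move=> D fk gk hk.
have fk_cons : conservative_flux fk (@ke_flux_x R).
  apply: (@conservative_ke_flux2 R _ (fun U => rho U * velx U)).
  by split=> [U1 U2 | U]; rewrite ?Fcons ?mxE // Fsym.
have gk_cons : conservative_flux gk (@ke_flux_y R).
  apply: (@conservative_ke_flux2 R _ (fun U => rho U * vely U)).
  by split=> [U1 U2 | U]; rewrite ?Gcons ?mxE // Gsym.
have hk_cons : conservative_flux hk (@ke_flux_z R).
  apply: (@conservative_ke_flux2 R _ (fun U => rho U * velz U)).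
  by split=> [U1 U2 | U]; rewrite ?Hcons ?mxE // Hsym.
have rateF V W :
    kinetic_energy_rate V (F V W) = fk V W + velx V * pt V W.
  have [Fx Fy Fz] := hF V W.
  by rewrite (@kinetic_energy_rate_mean_flux _ _ (pt V W) 0 0) ?addr0 //
             !mulr0 !addr0.
have rateG V W :
    kinetic_energy_rate V (G V W) = gk V W + vely V * pt V W.
  have [Gx Gy Gz] := hG V W.
  by rewrite (@kinetic_energy_rate_mean_flux _ _ 0 (pt V W) 0) ?addr0 //
             !mulr0 addr0 add0r.
have rateH V W :
    kinetic_energy_rate V (H V W) = hk V W + velz V * pt V W.
  have [Hx Hy Hz] := hH V W.
  by rewrite (@kinetic_energy_rate_mean_flux _ _ 0 0 (pt V W)) ?addr0 //
             !mulr0 !add0r.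
have balance (U : nodal_states R N) i j k :
    kinetic_energy_volume_terms D F G H U i j k =
    - flux_differencing D fk gk hk U i j k - pressure_work D pt U i j k.
  rewrite kinetic_energy_volume_termsE /flux_differencing /pressure_work.
  rewrite -opprD -mulrDr -big_split /=; congr (- (2 * _)).
  by apply: eq_bigr => m _; rewrite rateF rateG rateH; ring.
split.
- by exists fk, gk, hk, pt.
- by move=> U i j k; rewrite balance mulNr.
- by split; [case: fk_cons | case: gk_cons | case: hk_cons].
- by split; [case: fk_cons | case: gk_cons | case: hk_cons].
Qed.
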